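(* Let $(X,d)$ be a metric space. Then the following statements are equivalent. (1) $X$ is Bourbaki quasi-complete. (2) Every subsequence of a quasi-Cauchy sequence in $X$ has a cluster point in $X$. (3) Every real valued continuous function defined on $X$ is ward continuous.
   Context: Let $(X,d)$ be a metric space. A sequence $(x_n)$ in a metric space is quasi-Cauchy if for every $\varepsilon>0$ there is $n_0$ such that $d(x_{n+1},x_n)<\varepsilon$ for all $n\ge n_0$. A function between metric spaces is ward continuous if it maps quasi-Cauchy sequences to quasi-Cauchy sequences. For $\varepsilon>0$ and $p\in X$, $B^\infty_\varepsilon(p)$ is the set of points $q\in X$ for which there are finitely many points $p=p_0,p_1,\dots,p_n=q$ in $X$ with $d(p_{i-1},p_i)<\varepsilon$ for $i=1,\dots,n$. A sequence $(x_n)$ is Bourbaki quasi-Cauchy in $X$ if for every $\varepsilon>0$ there exist $n_0\in\mathbb{N}$ and $p\in X$ such that $x_n\in B^\infty_\varepsilon(p)$ for every $n\ge n_0$. $X$ is Bourbaki quasi-complete if every Bourbaki quasi-Cauchy sequence in $X$ has a cluster point in $X$. A cluster point of a sequence is the limit of some subsequence. *)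

(* Defs.v *)
From HB Require Import structures.
From mathcomp Require Import all_boot all_order all_algebra.
From mathcomp Require Import all_classical all_reals all_analysis.
Set Implicit Arguments.
Unset Strict Implicit.
Unset Printing Implicit Defensive.
Import Order.TTheory GRing.Theory Num.Theory numFieldNormedType.Exports.
Local Open Scope classical_set_scope.
Local Open Scope ring_scope.

Definition quasi_cauchy (R : realType) (X : metricType R) (x : nat -> X) : Prop :=
  forall e : R, 0 < e ->
    exists n0 : nat, forall n : nat, (n0 <= n)%N -> mdist (x n.+1) (x n) < e.

Definition ward_continuous (R : realType) (X Y : metricType R) (f : X -> Y) : Prop :=
  forall x : nat -> X, quasi_cauchy x -> quasi_cauchy (f \o x).

(* Only the values c 0, ..., c n of the chain are constrained. *)
Definition chain_ball (R : realType) (X : metricType R) (e : R) (p : X) : set X :=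
  [set q | exists (n : nat) (c : nat -> X),
    [/\ c 0%N = p, c n = q &
        forall i : nat, (i < n)%N -> mdist (c i) (c i.+1) < e]].

Definition bourbaki_quasi_cauchy (R : realType) (X : metricType R)
    (x : nat -> X) : Prop :=
  forall e : R, 0 < e ->
    exists (n0 : nat) (p : X), forall n : nat, (n0 <= n)%N -> chain_ball e p (x n).

(* The library's increasing_seq is a strict notion: it states that
   (s m <= s n) = (m <= n) for all m and n. *)
Definition cluster_point (R : realType) (X : metricType R) (x : nat -> X)
    (a : X) : Prop :=
  exists2 s : nat -> nat, increasing_seq s & x \o s @ \oo --> a.

Definition bourbaki_quasi_complete (R : realType) (X : metricType R) : Prop :=
  forall x : nat -> X, bourbaki_quasi_cauchy x -> exists a : X, cluster_point x a.

(* Main.v *)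
(* A quasi-Cauchy sequence is eventually chainable to one of its terms at every
   scale, and conversely a Bourbaki quasi-Cauchy sequence has a subsequence whose
   consecutive terms are chainable at scales tending to 0, hence a subsequence
   that is also a subsequence of a quasi-Cauchy sequence: this relates (1) and
   (2). Continuity at a cluster point of the indices where f o x jumps gives
   (2) => (3). For (3) => (2), if a subsequence of a quasi-Cauchy sequence y has
   no cluster point, then y keeps moving away from its values, which yields
   u_k = y (m_k) <> v_k = y (m_k + 1); after thinning out, {u_k} and {v_k} are
   disjoint closed sets, and a Urysohn function separating them jumps by 1
   between consecutive terms of y infinitely often. *)
Require Import Defs.
From HB Require Import structures.
From mathcomp Require Import all_boot all_order all_algebra.
From mathcomp Require Import all_classical all_reals all_analysis.
Import Order.TTheory GRing.Theory Num.Theory numFieldNormedType.Exports.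
Local Open Scope classical_set_scope.
Local Open Scope ring_scope.

(** * Choice of strictly increasing index sequences *)

Lemma increasing_seq_ge_id (s : nat -> nat) :
  increasing_seq s -> forall n, (n <= s n)%N.
Proof.
move=> /increasing_seqP sS; elim=> [//|n IHn].
exact: leq_ltn_trans IHn (sS n).
Qed.

(** Dependent choice: each index is picked knowing the previous one, as the thinning in
    [no_cluster_disjoint_subseq] requires. *)
Lemma increasing_choice (Q : nat -> nat -> nat -> Prop) :
  (forall k m, exists2 n, (m < n)%N & Q k m n) ->
  exists2 s : nat -> nat, increasing_seq s & forall k, Q k (s k) (s k.+1).
Proof.
move=> H.
pose g k m := sval (cid2 (H k m)).
pose s := fix s k := if k is k'.+1 then g k' (s k') else 0%N.
have gP k m : (m < g k m)%N /\ Q k m (g k m) by rewrite /g; case: cid2.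
exists s => [|k]; last by have [] := gP k (s k).
by apply/increasing_seqP => k; have [] := gP k (s k).
Qed.

Lemma increasing_choice_at (P : nat -> nat -> Prop) :
  (forall k m, exists2 n, (m <= n)%N & P k n) ->
  exists2 s : nat -> nat, increasing_seq s & forall k, P k (s k).
Proof.
move=> H; have [k m|s sS sP] := @increasing_choice (fun k _ n => P k n).
  by have [n mn Pn] := H k m.+1; exists n.
(* The choice constrains [s k.+1] only, not [s 0], hence the shift. *)
exists (s \o S) => [|k]; last exact: sP.
by move=> m n; rewrite [LHS]sS.
Qed.

Section MetricSequences.
Context {R : realType} {X : metricType R}.
Implicit Types (x y u v : nat -> X) (a : X).

(** * Cluster points in metric spaces *)

Lemma cluster_pointP x a :
  cluster_point x a <->
  forall (e : R) (m : nat), 0 < e -> exists2 n, (m <= n)%N & mdist (x n) a < e.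
Proof.
split=> [[s sS /metricType_numDomainType.cvgrPdist_lt xs] e m e0|H].
  have [N _ NP] := xs e e0; exists (s (maxn m N)).
    exact: leq_trans (leq_maxl m N) (increasing_seq_ge_id _ sS _).
  by rewrite metric_sym; apply: NP; rewrite /= leq_maxr.
have [k m|s sS sP] :=
    @increasing_choice_at (fun k n => mdist (x n) a < k.+1%:R^-1).
  by apply: H; rewrite invr_gt0 ltr0n.
exists s => //; apply/metricType_numDomainType.cvgrPdist_lt => e e0.
near=> k; rewrite metric_sym (lt_trans (sP k))//.
near: k; exact: near_infty_natSinv_lt (PosNum e0).
Unshelve. all: end_near. Qed.

Lemma cluster_point_subseq x (s : nat -> nat) a :
  (forall n, (n <= s n)%N) -> cluster_point (x \o s) a -> cluster_point x a.
Proof.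
move=> sn /cluster_pointP xsa; apply/cluster_pointP => e m e0.
have [n mn xn] := xsa e m e0; exists (s n) => //.
exact: leq_trans mn (sn n).
Qed.

Lemma cluster_point_asymptotic x y a :
  (forall e : R, 0 < e ->
    exists m : nat, forall n, (m <= n)%N -> mdist (x n) (y n) < e) ->
  cluster_point y a -> cluster_point x a.
Proof.
move=> xy /cluster_pointP ya; apply/cluster_pointP => e m e0.
have e20 : 0 < e / 2 by rewrite divr_gt0.
have [N xyN] := xy _ e20.
have [n] := ya _ (maxn m N) e20.
rewrite geq_max => /andP[mn Nn] yn; exists n => //.
by rewrite (le_lt_trans (metric_triangle _ (y n) _))// [e]splitr ltrD// xyN.
Qed.

(** If [a] is adherent to the range but outside it, and the terms from index [m] on stay at distance
    at least [e] from [a], then a small neighborhood of [a] also misses the finitely many earlier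
    terms, hence the whole range: a contradiction. *)
Lemma closed_range_no_cluster x :
  ~ (exists a, cluster_point x a) -> closed (range x).
Proof.
move=> xN a cla; apply: contrapT => aN; apply: xN; exists a.
apply/cluster_pointP => e m e0; apply: contrapT => /forall2NP xfar.
have avoid k : \forall q \near a, forall n, (n < k)%N -> x n <> q.
  elim: k => [|k IHk]; first exact: nearW.
  have xka : x k != a by apply/eqP => xka; apply: aN; exists k.
  have ball_k : \forall q \near a, mdist a q < mdist (x k) a.
    by apply/metricType_numDomainType.nbhs_mdistP; exists (mdist (x k) a);
      rewrite //= mdist_gt0.
  near=> q => n; rewrite ltnS leq_eqVlt => /orP[/eqP -> xkq|nk].
    have : mdist a q < mdist (x k) a by near: q.
    by rewrite -xkq metric_sym ltxx.
  by move: n nk; near: q.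
have : nbhs a [set q | mdist a q < e /\ forall n, (n < m)%N -> x n <> q].
  apply: filterI; last exact: avoid.
  by apply/metricType_numDomainType.nbhs_mdistP; exists e.
move=> /cla[_ [[n _ <-]]] [xna /(_ n)].
have [nm /(_ isT)//|mn _] := ltnP n m.
by have [//|] := xfar n; rewrite metric_sym.
Unshelve. all: end_near. Qed.

(** * Chains and interpolation *)

Lemma chain_ball_refl (e : R) (p : X) : chain_ball e p p.
Proof. by exists 0%N, (fun=> p). Qed.

Lemma chain_ball_step (e : R) (p q r : X) :
  chain_ball e p q -> mdist q r < e -> chain_ball e p r.
Proof.
move=> [n [c [c0 cn cS]]] qr.
exists n.+1, (fun i => if (i <= n)%N then c i else r); rewrite ltnn.
split=> // i /[!ltnS] i_n; rewrite i_n; case: ltnP => [/cS //|n_i].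
suff -> : i = n by rewrite cn.
by apply/eqP; rewrite eqn_leq i_n.
Qed.

Lemma chain_ball_trans (e : R) (p q r : X) :
  chain_ball e p q -> chain_ball e q r -> chain_ball e p r.
Proof.
move=> pq [n [c [c0 <- cS]]].
suff: forall i, (i <= n)%N -> chain_ball e p (c i) by exact.
elim=> [|i IHi] i_n; first by rewrite c0.
exact: chain_ball_step (IHi (ltnW i_n)) (cS i i_n).
Qed.

Lemma chain_ball_sym (e : R) (p q : X) : chain_ball e p q -> chain_ball e q p.
Proof.
move=> [n [c [<- <- cS]]].
suff: forall i, (i <= n)%N -> chain_ball e (c i) (c 0%N) by exact.
elim=> [|i IHi] i_n; first exact: chain_ball_refl.
apply: chain_ball_trans (IHi (ltnW i_n)).
apply: chain_ball_step (chain_ball_refl _ _) _.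
by rewrite metric_sym cS.
Qed.

Lemma quasi_cauchy_chain_ball x (e : R) : quasi_cauchy x -> 0 < e ->
  exists m : nat, forall n, (m <= n)%N -> chain_ball e (x m) (x n).
Proof.
move=> xq e0; have [m xm] := xq e e0; exists m.
elim=> [|n IHn]; first by rewrite leqn0 => /eqP ->; exact: chain_ball_refl.
rewrite leq_eqVlt => /orP[/eqP ->|mn]; first exact: chain_ball_refl.
by apply: chain_ball_step (IHn mn) _; rewrite metric_sym xm.
Qed.

(* The chains from [u k] to [u k.+1] are run through one after the other; each
   is taken with at least one step, so that the visit times of the [u k] are
   strictly increasing. *)
Lemma quasi_cauchy_interpolation u :
  (forall k, chain_ball k.+1%:R^-1 (u k) (u k.+1)) ->
  exists (y : nat -> X) (s : nat -> nat),
    [/\ quasi_cauchy y, increasing_seq s & y \o s = u].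
Proof.
move=> uS.
have /choice[lc lcP] : forall k, exists lc : nat * (nat -> X),
    [/\ lc.2 0%N = u k, lc.2 lc.1.+1 = u k.+1 &
      forall i, (i <= lc.1)%N -> mdist (lc.2 i) (lc.2 i.+1) < k.+1%:R^-1].
  move=> k; have [n [c [c0 cn cS]]] := uS k.
  (* A stationary step is appended, so the chain has [lc.1.+1] steps. *)
  exists (n, fun i => if (i <= n)%N then c i else u k.+1); rewrite /= ltnn.
  split=> // i i_n; rewrite i_n; case: ltnP => [/cS //|n_i].
  suff -> : i = n by rewrite cn mdistxx invr_gt0 ltr0n.
  by apply/eqP; rewrite eqn_leq i_n.
pose l k := (lc k).1; pose c k := (lc k).2.
(* A state [(k, r)] is position [r] on chain [k]. The endpoint of chain [k] is skipped, being the
   start of chain [k.+1]. *)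
pose next (kr : nat * nat) :=
  if (kr.2 < l kr.1)%N then (kr.1, kr.2.+1) else (kr.1.+1, 0%N).
pose st n := iter n next (0%N, 0%N).
pose s k := (\sum_(i < k) (l i).+1)%N.
have sS k : s k.+1 = (s k + l k).+1 by rewrite /s big_ord_recr /= addnS.
have st_s k r : (r <= l k)%N -> st (s k + r)%N = (k, r).
  elim: k r => [|k IHk]; elim=> [|r IHr] rl.
  - by rewrite /s big_ord0.
  - by rewrite addnS /st iterS -/(st _) IHr ?(ltnW rl)// /next /= rl.
  - by rewrite addn0 sS /st iterS -/(st _) IHk// /next /= ltnn.
  - by rewrite addnS /st iterS -/(st _) IHr ?(ltnW rl)// /next /= rl.
have st_le n : ((st n).2 <= l (st n).1)%N.
  elim: n => [//|n IHn]; rewrite /st iterS -/(st n) /next.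
  by case: ifP.
have st_homo : {homo (fun n => (st n).1) : m n / (m <= n)%N}.
  apply: homo_leq (@leqnn) (@leq_trans) _ => n.
  by rewrite /st iterS -/(st n) /next; case: ifP.
exists (fun n => c (st n).1 (st n).2), s; split.
- move=> e e0; have [K _ KP] := near_infty_natSinv_lt (PosNum e0).
  exists (s K) => n Kn.
  have Kst : (K <= (st n).1)%N.
    by have := st_homo _ _ Kn; rewrite -[s K]addn0 st_s.
  apply: lt_trans (KP _ Kst); rewrite metric_sym.
  have [_ cl cS] := lcP (st n).1.
  have [c0 _ _] := lcP (st n).1.+1.
  have := cS _ (st_le n); rewrite /st iterS -/(st n) /next.
  case: ltnP => //= ln.
  suff -> : (st n).2 = l (st n).1 by rewrite /c c0 -cl.
  by apply/eqP; rewrite eqn_leq st_le.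
- by apply/increasing_seqP => k; rewrite sS ltEnat /= ltnS leq_addr.
- apply/funext => k /=; rewrite -[s k]addn0 st_s //=.
  by have [] := lcP k.
Qed.

(** At each scale any two late terms are chained through the centre [p]; [s k] is taken so late that
    this holds at scale 1/(k+1). *)
Lemma bourbaki_quasi_cauchy_subseq x : bourbaki_quasi_cauchy x ->
  exists2 s : nat -> nat, increasing_seq s &
    forall k, chain_ball k.+1%:R^-1 (x (s k)) (x (s k.+1)).
Proof.
move=> xb; have [k m|s sS sP] := @increasing_choice_at
    (fun k n => forall i, (n <= i)%N -> chain_ball k.+1%:R^-1 (x n) (x i)).
  have [|N [p xp]] := xb k.+1%:R^-1; first by rewrite invr_gt0 ltr0n.
  exists (maxn m N); first exact: leq_maxl.
  move=> i; rewrite geq_max => /andP[_ Ni].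
  apply: chain_ball_trans (xp i Ni); apply: chain_ball_sym.
  by apply: xp; exact: leq_maxr.
exists s => // k; apply: sP.
by rewrite [(s k <= s k.+1)%N]sS.
Qed.

(** * Sequences without cluster points *)

Lemma next_change y m : (exists2 n, (m <= n)%N & y n <> y m) ->
  exists n, [/\ (m <= n)%N, y n = y m & y n.+1 <> y n].
Proof.
move=> [n mn ynm]; apply: contrapT => /forallNP H; apply: ynm.
elim: n mn => [|n IHn]; first by rewrite leqn0 => /eqP ->.
rewrite leq_eqVlt => /orP[/eqP -> //|mn].
apply: contrapT => yS; apply: (H n); split=> //; first exact: IHn.
by rewrite (IHn mn).
Qed.

(** A value taken at arbitrarily large indices is itself a cluster point. *)
Lemma no_cluster_leaves x (a : X) : ~ (exists a, cluster_point x a) ->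
  exists m : nat, forall n, (m <= n)%N -> x n <> a.
Proof.
move=> xN; apply: contrapT => /forallNP H; apply: xN; exists a.
apply/cluster_pointP => e m e0; have /existsNP[n /not_implyP[mn]] := H m.
by move=> /contrapT xna; exists n; rewrite // xna mdistxx.
Qed.

Lemma no_cluster_leaves_prefix x y m : ~ (exists a, cluster_point x a) ->
  exists N : nat, forall n i, (N <= n)%N -> (i <= m)%N -> x n <> y i.
Proof.
move=> xN; elim: m => [|m [N NP]].
  have [N NP] := @no_cluster_leaves x (y 0%N) xN.
  by exists N => n i Nn; rewrite leqn0 => /eqP ->; exact: NP.
have [N' NP'] := @no_cluster_leaves x (y m.+1) xN.
exists (maxn N N') => n i; rewrite geq_max => /andP[Nn N'n].
by rewrite leq_eqVlt => /orP[/eqP ->|im]; [exact: NP'|exact: NP].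
Qed.

(** Each new index is so late that neither sequence takes there a value the other had up to the
    previous index; the pointwise hypothesis settles equal indices. *)
Lemma no_cluster_disjoint_subseq x y :
  ~ (exists a, cluster_point x a) -> ~ (exists a, cluster_point y a) ->
  (forall n, x n <> y n) ->
  exists2 t : nat -> nat, increasing_seq t &
    range (x \o t) `&` range (y \o t) = set0.
Proof.
move=> xN yN xy.
have [k m|t tS tP] := @increasing_choice
    (fun _ m n => forall i, (i <= m)%N -> x n <> y i /\ y n <> x i).
  have [N NP] := @no_cluster_leaves_prefix x y m xN.
  have [N' NP'] := @no_cluster_leaves_prefix y x m yN.
  exists (maxn m.+1 (maxn N N')); first exact: leq_maxl.
  by move=> i im; split; [apply: NP|apply: NP'] => //;
    rewrite !leq_max leqnn ?orbT.
have tlt i j : (i < j)%N -> x (t j) <> y (t i) /\ y (t j) <> x (t i).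
  by case: j => // j ij; apply: tP; rewrite [(_ <= _)%N]tS.
exists t => //; rewrite -subset0 => q [[i _ <-] [j _]] /=.
have [/tlt[]|/tlt[]|->] := ltngtP i j; [by []|by move=> + _ /esym|].
by move=> /esym/xy.
Qed.

(** Both ranges are closed and a metric space is normal, so Urysohn's lemma applies. *)
Lemma real_continuous_separation u v :
  ~ (exists a, cluster_point u a) -> ~ (exists a, cluster_point v a) ->
  range u `&` range v = set0 ->
  exists f : X -> R^o,
    [/\ continuous f, forall n, f (u n) = 0 & forall n, f (v n) = 1].
Proof.
move=> /closed_range_no_cluster cu /closed_range_no_cluster cv uv0.
have [f [cf fu fv _]] :=
  urysohn_ext_itv (@pseudometric_normal R X) cu cv uv0 (@ltr01 R).
exists f; split=> // n; [apply: fu|apply: fv]; exact/imageP/imageT.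
Qed.

End MetricSequences.

(** * The three implications *)

Section WardContinuity.
Context {R : realType} {X : metricType R}.

Lemma bourbaki_quasi_complete_cluster (x : nat -> X) (s : nat -> nat) :
  bourbaki_quasi_complete X -> quasi_cauchy x -> increasing_seq s ->
  exists a, cluster_point (x \o s) a.
Proof.
move=> XB xq sS; apply: XB => e e0.
have [m xm] := @quasi_cauchy_chain_ball _ _ x e xq e0.
exists m, (x m) => n mn; apply: xm.
exact: leq_trans mn (increasing_seq_ge_id _ sS n).
Qed.

Lemma continuous_ward (f : X -> R^o) :
  (forall (x : nat -> X) (s : nat -> nat),
     quasi_cauchy x -> increasing_seq s ->
     exists a : X, cluster_point (x \o s) a) ->
  continuous f -> ward_continuous f.
Proof.
move=> X2 cf x xq e e0; apply: contrapT => /forallNP H.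
have [k m|s sS sP] := @increasing_choice_at
    (fun _ n => e <= mdist (f (x n.+1)) (f (x n))).
  have /existsNP[n /not_implyP[mn /negP]] := H m.
  by rewrite -leNgt => ?; exists n.
have [a /cluster_pointP xa] := X2 x s xq sS.
have e20 : 0 < e / 2 by rewrite divr_gt0.
have /metricType_numDomainType.cvgrPdist_lt/(_ _ e20) := cf a.
move=> /metricType_numDomainType.nbhs_mdistP[d /= d0 fd].
(* Half of [d] brings [x (s k)] close to [a], the other half pays for the step to its successor. *)
have d20 : 0 < d / 2 by rewrite divr_gt0.
have [N xN] := xq _ d20.
have [k Nk xka] := xa _ N d20.
have skN : (N <= s k)%N := leq_trans Nk (increasing_seq_ge_id _ sS k).
have fx : mdist (f a) (f (x (s k))) < e / 2.
  apply: fd => /=; rewrite metric_sym (lt_le_trans xka)//.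
  by rewrite {2}[d]splitr lerDl ltW.
have fxS : mdist (f a) (f (x (s k).+1)) < e / 2.
  apply: fd => /=; rewrite metric_sym.
  rewrite (le_lt_trans (metric_triangle _ (x (s k)) _))// [d]splitr ltrD//.
  exact: xN.
have := sP k; rewrite leNgt => /negP; apply.
rewrite (le_lt_trans (metric_triangle _ (f a) _))// [e]splitr ltrD//.
by rewrite metric_sym.
Qed.

Lemma ward_continuous_cluster (y : nat -> X) (s : nat -> nat) :
  (forall f : X -> R^o, continuous f -> ward_continuous f) ->
  quasi_cauchy y -> increasing_seq s -> exists a, cluster_point (y \o s) a.
Proof.
move=> X3 yq sS; apply: contrapT => zN.
have s_ge := increasing_seq_ge_id _ sS.
(* Moving from [s k] to the next change of value keeps the value, so [y \o m] still has no cluster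
   point although [m] need not be increasing. *)
have /choice[m mP] k :
    exists n, [/\ (s k <= n)%N, y n = y (s k) & y n.+1 <> y n].
  apply: next_change; have [N NP] := @no_cluster_leaves _ _ _ (y (s k)) zN.
  exists (s (maxn k N)); first by rewrite [(_ <= _)%N]sS leq_maxl.
  exact/NP/leq_maxr.
have m_ge k : (k <= m k)%N by have [/(leq_trans (s_ge k))] := mP k.
have uE : y \o m = y \o s by apply/funext => k /=; have [] := mP k.
have uN : ~ (exists a, cluster_point (y \o m) a) by rewrite uE.
(* The successors are asymptotic to [y \o m], since [y] is quasi-Cauchy and [m] tends to
   infinity. *)
have vN : ~ (exists a, cluster_point (y \o S \o m) a).
  move=> [a va]; apply: uN; exists a; apply: cluster_point_asymptotic va.
  move=> e /yq[N yN]; exists N => n Nn; rewrite metric_sym.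
  by apply: yN; exact: leq_trans Nn (m_ge n).
have [k /esym|t tS uv0] := @no_cluster_disjoint_subseq _ _ _ _ uN vN.
  by have [] := mP k.
have t_ge := increasing_seq_ge_id _ tS.
have [||f [cf fu fv]] := real_continuous_separation _ _ _ _ uv0.
- by move=> [a /(cluster_point_subseq _ _ _ t_ge) ua]; apply: uN; exists a.
- by move=> [a /(cluster_point_subseq _ _ _ t_ge) va]; apply: vN; exists a.
(* At time [m (t N)] the sequence [f \o y] passes from 0 to 1, against the bound 1 on its late
   steps. *)
have [N fN] := X3 f cf y yq 1 ltr01.
have := fN (m (t N)) (leq_trans (t_ge N) (m_ge (t N))).
by rewrite /= (fu N) (fv N) /mdist /= sub0r normrN normr1 ltxx.
Qed.

Lemma cluster_bourbaki_quasi_complete :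
  (forall (x : nat -> X) (s : nat -> nat),
     quasi_cauchy x -> increasing_seq s ->
     exists a : X, cluster_point (x \o s) a) ->
  bourbaki_quasi_complete X.
Proof.
move=> X2 x /bourbaki_quasi_cauchy_subseq[t tS xt].
have [y [s [yq sS ys]]] := @quasi_cauchy_interpolation _ _ (x \o t) xt.
have [a] := X2 y s yq sS; rewrite ys => xta; exists a.
exact: cluster_point_subseq (increasing_seq_ge_id _ tS) xta.
Qed.

End WardContinuity.

Theorem theorem3p4 (R : realType) (X : metricType R) :
  [<-> bourbaki_quasi_complete X;
       forall (x : nat -> X) (s : nat -> nat),
         quasi_cauchy x -> increasing_seq s ->
         exists a : X, cluster_point (x \o s) a;
       forall f : X -> R^o, continuous f -> ward_continuous f].
Proof.
tfae.
- by move=> XB x s; exact: bourbaki_quasi_complete_cluster.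
- by move=> X2 f; exact: continuous_ward.
- move=> X3; apply: cluster_bourbaki_quasi_complete => x s.
  exact: ward_continuous_cluster.
Qed.
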